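(* Let $G=(X,b)$ be a connected graph. Then $G$ is canonically compactifiable if and only if the space $\mathfrak{D}(G)$ of functions of finite Dirichlet energy is an algebra (with respect to pointwise addition and multiplication of functions).
   Context: A graph $G=(X,b)$ consists of a nonempty countable set $X$ (nodes) and a symmetric function $b:X\times X\to[0,\infty)$ with $b(x,x)=0$ for all $x$ and $\sum_{y\in X}b(x,y)<\infty$ for all $x\in X$. (Local finiteness is not assumed.) Two nodes $x,y$ are connected if there is a finite sequence $x=x_0,\ldots,x_n=y$ with $b(x_k,x_{k+1})>0$ for all $0\le k<n$; the graph is connected if all its nodes are connected to each other. The Dirichlet energy of $f:X\to\mathbb{C}$ is $\tilde{Q}(f)=\frac12\sum_{x,y\in X}b(x,y)|f(x)-f(y)|^2\in[0,\infty]$, and $\mathfrak{D}(G)=\{f:X\to\mathbb{C}\mid \tilde{Q}(f)<\infty\}$, which is a vector space. That $\mathfrak{D}(G)$ is an algebra means that it is closed under pointwise multiplication: $fg\in\mathfrak{D}(G)$ for all $f,g\in\mathfrak{D}(G)$. The graph is canonically compactifiable if $\mathfrak{D}(G)\subseteq\ell^\infty(X)$, i.e. every function of finite energy is bounded. *)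

(* Defs.v *)
From HB Require Import structures.
From mathcomp Require Import all_boot all_order all_algebra.
From mathcomp Require Import complex.
From mathcomp Require Import all_classical all_reals all_analysis.
From mathcomp Require Import ring.

Set Implicit Arguments.
Unset Strict Implicit.
Unset Printing Implicit Defensive.

Import Order.TTheory GRing.Theory Num.Theory.
Import ComplexField.Normc.

Local Open Scope classical_set_scope.
Local Open Scope ring_scope.

Record graph (R : realType) (X : countType) := Graph {
  weight :> X -> X -> R;
  graph_nonempty : [set: X] !=set0;
  weight_ge0 : forall x y, 0 <= weight x y;
  weight_sym : forall x y, weight x y = weight y x;
  weight_diag : forall x, weight x x = 0;
  weight_summable : forall x, (\esum_(y in [set: X]) (weight x y)%:E < +oo)%E
}.

Section GraphDefs.
Context {R : realType} {X : countType}.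
Implicit Types (b : graph R X) (f g : X -> R[i]).

Definition linked b (x y : X) : Prop :=
  exists s : seq X, path (fun u v => 0 < b u v) x s /\ last x s = y.

Definition connected_graph b : Prop := forall x y, linked b x y.

(* [normc] is the real-valued modulus; the sum is over all ordered pairs of
   nodes and takes values in the extended reals. *)
Definition energy b f : \bar R :=
  ((2^-1)%:E *
   \esum_(p in [set: X * X]) (b p.1 p.2 * normc (f p.1 - f p.2) ^+ 2)%:E)%E.

Definition finite_energy b : set (X -> R[i]) :=
  [set f | (energy b f < +oo)%E].

Definition ell_infty : set (X -> R[i]) :=
  [set f | exists M : R, forall x, normc (f x) <= M].

Definition canonically_compactifiable b : Prop :=
  finite_energy b `<=` ell_infty.

(* [finite_energy b] is always a vector subspace of the space of all functions
   (lemmas [finite_energyD] and [finite_energyZ]), hence an algebra exactly when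
   it is closed under the pointwise product [f \* g]. *)
Definition is_algebra b : Prop :=
  forall f g, finite_energy b f -> finite_energy b g -> finite_energy b (f \* g).

Local Definition edge_energy b f (p : X * X) : R := b p.1 p.2 * normc (f p.1 - f p.2) ^+ 2.

Local Lemma edge_energy_ge0 b f p : 0 <= edge_energy b f p.
Proof. by rewrite mulr_ge0 ?weight_ge0 ?sqr_ge0. Qed.

Lemma finite_energyE b f : finite_energy b f =
  (\esum_(p in [set: X * X]) (b p.1 p.2 * normc (f p.1 - f p.2) ^+ 2)%:E
   < +oo)%E :> Prop.
Proof.
rewrite /finite_energy /energy /=.
set S := (\esum_(p in _) _)%E.
have : (0 <= S)%E by apply: esum_ge0 => p _; rewrite lee_fin edge_energy_ge0.
case: S => [r| |] //= _; first by rewrite -EFinM !ltry.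
by rewrite gt0_muley // lte_fin invr_gt0.
Qed.

Local Lemma le_finite_energy b f g h (n : nat) :
  (forall x y, normc (h x - h y) ^+ 2 <=
     (normc (f x - f y) ^+ 2 + normc (g x - g y) ^+ 2) *+ n) ->
  finite_energy b f -> finite_energy b g -> finite_energy b h.
Proof.
move=> hle; rewrite !finite_energyE => fE gE.
have fgE k : (\esum_(p in [set: X * X])
    ((edge_energy b f p + edge_energy b g p) *+ k)%:E < +oo)%E.
  elim: k => [|k IHk]; first by rewrite esum1.
  under eq_esum => p _ do rewrite mulrS EFinD EFinD.
  rewrite !esumD; try by move=> p _; rewrite -?EFinD lee_fin
    ?mulrn_wge0 ?addr_ge0 ?edge_energy_ge0.
  by rewrite !lte_add_pinfty.
apply: le_lt_trans (fgE n); apply: le_esum => -[x y] _ /=.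
by rewrite lee_fin -mulrDr -mulrnAr ler_wpM2l ?weight_ge0.
Qed.

Lemma finite_energyD b f g :
  finite_energy b f -> finite_energy b g -> finite_energy b (f \+ g).
Proof.
apply: (@le_finite_energy _ _ _ _ 2) => x y /=.
have -> : f x + g x - (f y + g y) = f x - f y + (g x - g y).
  by rewrite opprD addrACA.
set u := f x - f y; set v := g x - g y.
have n0 (z : R[i]) : 0 <= normc z by case: z => ? ?; exact: sqrtr_ge0.
apply: (@le_trans _ _ ((normc u + normc v) ^+ 2)).
  by rewrite lerXn2r ?nnegrE ?addr_ge0 ?le_normcD.
rewrite -subr_ge0.
have -> : (normc u ^+ 2 + normc v ^+ 2) *+ 2 - (normc u + normc v) ^+ 2 =
  (normc u - normc v) ^+ 2 by ring.
exact: sqr_ge0.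
Qed.

Lemma finite_energyZ b (c : R[i]) f :
  finite_energy b f -> finite_energy b (c \*o f).
Proof.
move=> fE.
apply: (@le_finite_energy _ f f _ (Num.bound (normc c ^+ 2))) => // x y /=.
rewrite -mulrBr normcM exprMn -mulr_natl ler_pM ?sqr_ge0 //.
  by rewrite ltW // archi_boundP ?sqr_ge0.
by rewrite lerDl sqr_ge0.
Qed.

End GraphDefs.

(* Main.v *)
(* If all functions of finite energy are bounded, the product rule
   fg(x) - fg(y) = f(x)(g(x) - g(y)) + g(y)(f(x) - f(y)) gives closure under
   products. Conversely let f be unbounded of finite energy and F = |f - f(o)|.
   The slices [step k F] of F between the levels k and k + 1 have positive
   energies, by connectedness, whose sum is at most the energy of F. Hence one
   can choose levels k_0 < k_1 < ... whose slices s_n have energies e_n tending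
   to 0 as fast as desired. With c_n = 2^-(n+1) / sqrt e_n the function
   h = sum_n c_n s_n has finite energy. On the n+1-st slice h is at least c_n, so
   the energy of h^2 is at least c_n^2 c_(n+1)^2 e_(n+1), which is unbounded in n
   if the e_n decay fast enough. *)
Require Import Defs.
From mathcomp Require Import all_boot all_order all_algebra.
From mathcomp Require Import complex ring lra.
From mathcomp Require Import all_classical all_reals all_analysis.

Set Implicit Arguments.
Unset Strict Implicit.
Unset Printing Implicit Defensive.

Import Order.TTheory GRing.Theory Num.Theory.
Import ComplexField.Normc.

Local Open Scope classical_set_scope.
Local Open Scope ring_scope.

(** * Moduli of complex numbers and sums of nonnegative families *)

Lemma normc_ge0 (R : rcfType) (z : R[i]) : 0 <= normc z.
Proof. by case: z => x y; exact: sqrtr_ge0. Qed.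

Lemma normc_real (R : rcfType) (x : R) : normc (x%:C)%C = `|x|.
Proof. by rewrite /normc /= expr0n /= addr0 sqrtr_sqr. Qed.

Lemma le_dist_normc (R : rcfType) (u v : R[i]) :
  `|normc u - normc v| <= normc (u - v).
Proof.
have le_sub (a c : R[i]) : normc a - normc c <= normc (a - c).
  by rewrite lerBlDr -{1}(subrK c a) le_normcD.
rewrite ler_norml le_sub andbT lerNl opprB (le_trans (le_sub _ _)) //.
by rewrite -(@normcN _ (v - u)) opprB.
Qed.

Lemma le_esumZ (R : realType) (T : choiceType) (I : set T) (K : R)
    (a b : T -> \bar R) :
  0 <= K -> (forall i, 0 <= b i)%E ->
  (forall i, I i -> a i <= K%:E * b i)%E ->
  (\esum_(i in I) a i <= K%:E * \esum_(i in I) b i)%E.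
Proof.
move=> K0 b0 aKb; apply: (le_trans (le_esum aKb)).
apply: ge_ereal_sup => _ [A [finA AI] <-].
rewrite -ge0_mule_fsumr //; apply: lee_wpmul2l; first by rewrite lee_fin.
by apply: ereal_sup_ubound; exists A.
Qed.

(** Tonelli: both sides are sums over pairs, matched by swapping the coordinates. *)
Lemma esum_nneseries (R : realType) (T : choiceType) (I : set T)
    (a : nat -> T -> \bar R) :
  (forall n i, 0 <= a n i)%E ->
  (\esum_(i in I) \sum_(0 <= n <oo) a n i =
   \sum_(0 <= n <oo) \esum_(i in I) a n i)%E.
Proof.
move=> a0.
rewrite nneseries_esumT; last by move=> n; exact: esum_ge0.
under eq_esum do rewrite nneseries_esumT //.
rewrite !esum_esum //=.
rewrite (reindex_esum (setT `*` I) _ (fun p => (p.2, p.1))) //.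
by split=> [[n i] []|[n i] [m j] _ _ [-> ->]|[i n] []] //=; exists (n, i).
Qed.

(** * The Dirichlet form of real functions *)

Section DirichletForm.
Context {R : realType} {X : countType}.
Implicit Types (b : graph R X) (f g : X -> R[i]) (u v : X -> R).

(** Twice the energy of [u]; the factor 1/2 is irrelevant for finiteness. *)
Definition form b u : \bar R :=
  \esum_(p in [set: X * X]) (b p.1 p.2 * (u p.1 - u p.2) ^+ 2)%:E.

Lemma form_ge0 b u : (0 <= form b u)%E.
Proof.
by apply: esum_ge0 => p _; rewrite lee_fin mulr_ge0 ?weight_ge0 ?sqr_ge0.
Qed.

Lemma finite_energy_real b u :
  finite_energy b (fun x => (u x)%:C%C) = (form b u < +oo)%E :> Prop.
Proof.
rewrite finite_energyE /form; congr (is_true (_ < _)%E).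
by apply: eq_esum => p _; rewrite -rmorphB normc_real real_normK ?num_real.
Qed.

Lemma le_formZ b (K : R) u v : 0 <= K ->
  (forall x y, (u x - u y) ^+ 2 <= K * (v x - v y) ^+ 2) ->
  (form b u <= K%:E * form b v)%E.
Proof.
move=> K0 uv; apply: le_esumZ => // p; last move=> _.
  by rewrite lee_fin mulr_ge0 ?weight_ge0 ?sqr_ge0.
by rewrite -EFinM lee_fin [leRHS]mulrCA ler_wpM2l ?weight_ge0.
Qed.

Lemma le_form b u v : (forall x y, `|u x - u y| <= `|v x - v y|) ->
  (form b u <= form b v)%E.
Proof.
move=> uv; rewrite -[leRHS]mul1e; apply: le_formZ => // x y.
by rewrite mul1r -[leLHS]real_normK ?num_real // -[leRHS]real_normK ?num_real //
  lerXn2r ?nnegrE.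
Qed.

Lemma form_dist_lt b f (o : X) : finite_energy b f ->
  (form b (fun x => normc (f x - f o)%R) < +oo)%E.
Proof.
rewrite finite_energyE; apply: le_lt_trans; apply: le_esum => -[x y] _ /=.
rewrite lee_fin ler_wpM2l ?weight_ge0 // -[leLHS]real_normK ?num_real //.
rewrite lerXn2r ?nnegrE ?normc_ge0 // (le_trans (le_dist_normc _ _)) //.
by rewrite opprB addrA subrK.
Qed.

Lemma form_le_sum b (n : nat) (u : nat -> X -> R) v :
  (forall x y, \sum_(i < n) (u i x - u i y) ^+ 2 <= (v x - v y) ^+ 2) ->
  (\sum_(i < n) form b (u i) <= form b v)%E.
Proof.
move=> uv; rewrite /form -esum_sum; last first.
  by move=> p i _ _; rewrite lee_fin mulr_ge0 ?weight_ge0 ?sqr_ge0.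
apply: le_esum => p _; rewrite sumEFin lee_fin -mulr_sumr.
by rewrite ler_wpM2l ?weight_ge0.
Qed.

(** The cutoff [N] may depend on the pair of nodes: the bound is used term by term with the full
    series, and Tonelli then exchanges the two sums. *)
Lemma form_le_nneseries b (a : nat -> R) (u : nat -> X -> R) v :
  (forall n, 0 <= a n) ->
  (forall x y, exists N, (v x - v y) ^+ 2 <=
    \sum_(0 <= n < N) a n * (u n x - u n y) ^+ 2) ->
  (form b v <= \sum_(0 <= n <oo) (a n)%:E * form b (u n))%E.
Proof.
move=> a0 uv.
have t0 n (p : X * X) :
    (0 <= (a n * (b p.1 p.2 * (u n p.1 - u n p.2) ^+ 2))%:E)%E.
  by rewrite lee_fin mulr_ge0 // mulr_ge0 ?weight_ge0 ?sqr_ge0.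
apply: (@le_trans _ _ (\sum_(0 <= n <oo) \esum_(p in [set: X * X])
    (a n * (b p.1 p.2 * (u n p.1 - u n p.2) ^+ 2))%:E)%E).
  rewrite -esum_nneseries //; apply: le_esum => -[x y] _ /=.
  have [N vN] := uv x y.
  apply: le_trans (nneseries_lim_ge N _) => //; last by move=> n _ _; exact: (t0 n (x, y)).
  rewrite sumEFin lee_fin; under eq_bigr do rewrite mulrCA.
  by rewrite -mulr_sumr ler_wpM2l ?weight_ge0.
apply: lee_nneseries => n _ /=; first by move=> _; apply: esum_ge0.
apply: le_esumZ => // p.
by rewrite lee_fin mulr_ge0 ?weight_ge0 ?sqr_ge0.
Qed.

(** Each single term is bounded by the vanishing sum, so [u] agrees across every edge and hence
    along every path. *)
Lemma form_eq0 b u : connected_graph b -> form b u = 0%E ->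
  forall x y, u x = u y.
Proof.
move=> conn u0.
have eq_edge x y : 0 < b x y -> u x = u y.
  move=> bxy; apply/eqP; rewrite -subr_eq0 -sqrf_eq0 eq_le sqr_ge0 andbT.
  suff: ((b x y * (u x - u y) ^+ 2)%:E <= 0)%E by rewrite lee_fin pmulr_rle0.
  rewrite -u0.
  apply: esum_ge; exists [set (x, y)]; first by split.
  by rewrite fsbig_set1.
move=> x y; have [s [xs <-]] := conn x y.
elim: s x xs => //= z s IHs x /andP[/eq_edge -> /IHs]; exact.
Qed.

End DirichletForm.

(** * Slicing the real line at integer levels *)

Section Step.
Context {R : realType}.
Implicit Types (k : nat) (s t : R).

(** The truncation of [t - k] to [0, 1], written as a difference so that sums over consecutive [k]
    telescope. *)
Definition step k t : R := Num.min t k.+1%:R - Num.min t k%:R.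

Lemma step_eq0 k t : t <= k%:R -> step k t = 0.
Proof.
by move=> tk; rewrite /step !min_l ?subrr // (le_trans tk) ?ler_nat.
Qed.

Lemma step_eq1 k t : k.+1%:R <= t -> step k t = 1.
Proof.
move=> kt; rewrite /step !min_r //; last by rewrite (le_trans _ kt) ?ler_nat.
by rewrite -natrB ?subSnn.
Qed.

Lemma step_ge0 k t : 0 <= step k t.
Proof. by rewrite subr_ge0 le_min !ge_min lexx ler_nat leqnSn orbT. Qed.

Lemma step_mono k s t : s <= t -> 0 <= step k t - step k s <= t - s.
Proof.
rewrite /step -natr1 /Num.min => st; apply/andP.
by do 4![case: ltP => ?]; split; lra.
Qed.

Lemma step_homo k s t : s <= t -> step k s <= step k t.
Proof. by move=> /(step_mono k)/andP[]; rewrite subr_ge0. Qed.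

Lemma step_dist k s t : `|step k s - step k t| <= `|s - t|.
Proof.
wlog st : s t / s <= t => [IH|].
  have [/IH//|/ltW/IH] := leP s t.
  by rewrite distrC [leRHS]distrC.
have /andP[d0 dst] := step_mono k st.
by rewrite distrC ger0_norm // distrC ger0_norm ?subr_ge0.
Qed.

Lemma sum_step (m n : nat) t :
  \sum_(i < n) step (m + i) t = Num.min t (m + n)%:R - Num.min t m%:R.
Proof.
elim: n => [|n IHn]; first by rewrite big_ord0 addn0 subrr.
by rewrite big_ord_recr /= IHn /step addnS addrC addrA subrK.
Qed.

(** For t <= s each increment lies between 0 and s - t, so its square is at most s - t times itself;
    the increments telescope to at most s - t. *)
Lemma sum_sqr_step (m n : nat) s t :
  \sum_(i < n) (step (m + i) s - step (m + i) t) ^+ 2 <= (s - t) ^+ 2.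
Proof.
wlog ts : s t / t <= s => [IH|].
  have [/IH//|/ltW/IH] := leP t s.
  rewrite -(sqrrN (t - s)) opprB; under eq_bigr do rewrite -sqrrN opprB.
  exact.
apply: (@le_trans _ _ (\sum_(i < n) (s - t) * (step (m + i) s - step (m + i) t))).
  apply: ler_sum => i _; have /andP[d0 dst] := step_mono (m + i) ts.
  by rewrite expr2 ler_wpM2r.
rewrite -mulr_sumr sumrB !sum_step expr2 ler_wpM2l ?subr_ge0 // /Num.min.
have : m%:R <= (m + n)%:R :> R by rewrite ler_nat leq_addr.
by do 4![case: ltP => ?]; lra.
Qed.

End Step.

(* Cauchy-Schwarz against the weights 2^-(n+1), whose sum is at most 1. *)
Lemma sqr_sum_le (R : realDomainType) (N : nat) (d : nat -> R) :
  (\sum_(0 <= n < N) d n) ^+ 2 <= \sum_(0 <= n < N) 2 ^+ n.+1 * d n ^+ 2.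
Proof.
elim: N d => [|N IHN] d; first by rewrite !big_nil expr0n.
rewrite !big_nat_recl // expr1.
have IH := IHN (d \o S); rewrite /= in IH.
apply: (@le_trans _ _ (2 * d 0 ^+ 2 + 2 * (\sum_(0 <= i < N) d i.+1) ^+ 2)).
  set x := d 0; set y := \sum_(_ <= _ < _) _.
  by rewrite -subr_ge0 [leRHS](_ : _ = (x - y) ^+ 2) ?sqr_ge0 //; ring.
rewrite lerD2l; under [leRHS]eq_bigr do rewrite exprS -mulrA.
by rewrite -mulr_sumr ler_wpM2l.
Qed.

(** * An unbounded function of finite energy yields one whose square has infinite energy *)

Section Unbounded.
Context {R : realType} {X : countType}.
Variables (b : graph R X) (F : X -> R) (o : X).
Hypotheses (conn : connected_graph b) (formF : (form b F < +oo)%E).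
Hypotheses (F0 : forall x, 0 <= F x) (Fo : F o = 0).
Hypothesis F_unbounded : forall M, exists x, M < F x.

Definition step_form k : R := fine (form b (step k \o F)).

Lemma step_formE k : (step_form k)%:E = form b (step k \o F).
Proof.
apply: fineK; rewrite ge0_fin_numE ?form_ge0 //; apply: le_lt_trans formF.
by apply: le_form => x y; exact: step_dist.
Qed.

(** The slice is 0 at [o] and 1 at a node where [F] exceeds [k.+1], so it is not constant. *)
Lemma step_form_gt0 k : 0 < step_form k.
Proof.
rewrite -lte_fin step_formE lt0e form_ge0 andbT; apply/eqP => /(form_eq0 conn).
have [x Fx] := F_unbounded k.+1%:R => /(_ o x) /=; rewrite step_eq0 ?Fo //.
by rewrite step_eq1 ?ltW // => /eqP; rewrite eq_sym oner_eq0.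
Qed.

(** Otherwise more than M / e slices above level [m], each of form at least [e], would together
    exceed the form M of [F]. *)
Lemma step_form_small m (e : R) : 0 < e -> exists2 k, (m <= k)%N & step_form k < e.
Proof.
move=> e0; apply: contrapT => large.
have {}large i : e <= step_form (m + i).
  by rewrite leNgt; apply/negP => small; apply: large; exists (m + i)%N;
    rewrite ?leq_addr.
have [M FM] : exists M, form b F = M%:E.
  by exists (fine (form b F)); rewrite fineK // ge0_fin_numE ?form_ge0.
have M0 : 0 <= M by rewrite -lee_fin -FM form_ge0.
have := @form_le_sum _ _ b (Num.bound (M / e)) (fun i => step (m + i) \o F) F
  (fun x y => sum_sqr_step _ _ _ _).
under eq_bigr do rewrite -step_formE; rewrite sumEFin FM lee_fin leNgt => /negP.
apply; apply: (@lt_le_trans _ _ (\sum_(i < Num.bound (M / e)) e)).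
  rewrite sumr_const card_ord -mulr_natl -ltr_pdivrMr //.
  by rewrite archi_boundP // divr_ge0 // ltW.
exact: ler_sum.
Qed.

Lemma sparse_levels (e : nat -> R) : (forall n, 0 < e n) ->
  exists k : nat -> nat, (forall m n, (m < n)%N -> (k m < k n)%N) /\
    forall n, step_form (k n) < e n.
Proof.
move=> e0.
have [sel selP] : {sel : nat * nat -> nat |
    forall p, (p.1 <= sel p)%N /\ step_form (sel p) < e p.2}.
  have [sel selP] := @choice _ _ (fun p k => (p.1 <= k)%N /\ step_form k < e p.2)
    (fun p : nat * nat => let: ex_intro2 k a c := step_form_small p.1 (e0 p.2) in
      ex_intro _ k (conj a c)).
  by exists sel.
(* Searching from one past the previous level makes the levels strictly increase. *)
pose k := fix k n := if n is n'.+1 then sel ((k n').+1, n) else sel (0, 0)%N.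
exists k; split; last by case=> [|n]; exact: (selP _).2.
apply: (@homo_ltn _ k (fun i j => i < j)%N) => [? ? ?|n]; first exact: ltn_trans.
exact: (selP ((k n).+1, n.+1)).1.
Qed.

Lemma finite_form_square_infinite :
  exists h : X -> R, (form b h < +oo)%E /\ form b (h \* h) = +oo%E.
Proof.
(* Makes c_n^2 c_(n+1)^2 e_(n+1) = 4^-(n+1) / e_n * 4^-(n+2) exceed n + 1. *)
pose e n : R := (n.+1%:R * 4 ^+ (n.+1 + n.+2))^-1.
have e0 n : 0 < e n by rewrite invr_gt0 mulr_gt0 ?exprn_gt0 ?ltr0n.
have [k [kS ke]] := sparse_levels e0.
have le_k n : (n <= k n)%N.
  by elim: n => // n /leq_ltn_trans; apply; exact: kS.
pose c n : R := 2 ^- n.+1 / Num.sqrt (step_form (k n)).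
have c0 n : 0 < c n.
  by rewrite divr_gt0 ?invr_gt0 ?exprn_gt0 ?sqrtr_gt0 ?step_form_gt0.
have cE n : c n ^+ 2 * step_form (k n) = 4 ^- n.+1.
  rewrite expr_div_n sqr_sqrtr ?ltW ?step_form_gt0 // mulfVK; last first.
    by rewrite gt_eqF ?step_form_gt0.
  by rewrite exprVn exprAC -(natrX _ 2 2).
pose u n := step (k n) \o F.
(* The terms beyond the bound vanish, so [h] is the full series. *)
pose h x := \sum_(0 <= n < Num.bound (F x)) c n * u n x.
have u_eq0 n x : F x <= n%:R -> u n x = 0.
  by move=> Fn; apply: step_eq0; rewrite (le_trans Fn) ?ler_nat.
have hE x N : (Num.bound (F x) <= N)%N ->
    h x = \sum_(0 <= n < N) c n * u n x.
  move=> FN; rewrite /h (big_cat_nat _ FN) //= [X in _ + X]big_nat_cond.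
  rewrite [X in _ + X]big1 ?addr0 // => n; rewrite andbT => /andP[Fn _].
  rewrite u_eq0 ?mulr0 // ltW // (lt_le_trans (archi_boundP (F0 x))) //.
  by rewrite ler_nat.
have h_ge n x : c n * u n x <= h x.
  pose N := maxn (Num.bound (F x)) n.+1.
  rewrite (hE x N) ?leq_maxl // (bigD1_seq n) ?iota_uniq //=; last first.
    by rewrite mem_index_iota /= leq_maxr.
  by rewrite lerDl sumr_ge0 // => i _; rewrite mulr_ge0 ?step_ge0 // ltW.
(* All slices are monotone in [F], so dropping every term but the [n]-th only decreases the
   difference; [n.+1] in the cutoff keeps that term. *)
have h_diff n x y : F y <= F x -> c n * (u n x - u n y) <= h x - h y.
  move=> yx; pose N := maxn (maxn (Num.bound (F x)) (Num.bound (F y))) n.+1.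
  rewrite (hE x N) ?(hE y N) ?leq_max ?leqnn ?orbT // -sumrB.
  rewrite (bigD1_seq n) ?iota_uniq //=; last first.
    by rewrite mem_index_iota /= leq_maxr.
  rewrite -mulrBr lerDl sumr_ge0 // => i _.
  by rewrite -mulrBr mulr_ge0 ?subr_ge0 ?step_homo // ltW.
exists h; split.
- have := @form_le_nneseries _ _ b (fun n => 2 ^+ n.+1 * c n ^+ 2) u h.
  move=> /(_ _ _)/le_lt_trans; apply.
  + by move=> n; rewrite mulr_ge0 ?sqr_ge0 ?exprn_ge0.
  + move=> x y; pose N := maxn (Num.bound (F x)) (Num.bound (F y)).
    exists N; rewrite (hE x N) ?(hE y N) ?leq_maxl ?leq_maxr // -sumrB.
    apply: le_trans (sqr_sum_le _ _) _.
    by apply: ler_sum => n _; rewrite -mulrBr exprMn mulrA.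
  (* The weight 2^(n+1) times the form 4^-(n+1) of c_n u_n leaves the geometric series 2^-(n+1), of
     sum 1. *)
  + have tail : (\sum_(0 <= n <oo) (0 + (1 / (2 ^ n.+1)%:R)%:E) <= 1%:E :> \bar R)%E.
      apply: le_trans (@epsilon_trick R (fun=> 0%E) 1 xpredT _ _) _ => //.
      by rewrite eseries0 // add0e.
    apply: le_lt_trans (ltry 1); apply: le_trans tail; apply: lee_nneseries => n _ /=.
      by move=> _; rewrite mule_ge0 ?form_ge0 // lee_fin mulr_ge0 ?sqr_ge0 ?exprn_ge0.
    rewrite -step_formE add0e -EFinM lee_fin -mulrA cE.
    rewrite mul1r natrX (_ : 4 = 2 * 2) ?exprMn ?invfM ?mulrA ?divff ?mul1r //.
    by rewrite -natrM.
- apply/eqP; rewrite -leye_eq leNgt; apply/negP => hh.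
  have [M hhM] : exists M, form b (h \* h) = M%:E.
    by exists (fine (form b (h \* h))); rewrite fineK // ge0_fin_numE ?form_ge0.
  have M0 : 0 <= M by rewrite -lee_fin -hhM form_ge0.
  have diff n x y : (c n * c n.+1 * (u n.+1 x - u n.+1 y)) ^+ 2 <=
      (h x * h x - h y * h y) ^+ 2.
    wlog yx : x y / F y <= F x => [IH|].
      have [/IH//|/ltW/IH] := leP (F y) (F x).
      rewrite -(sqrrN (_ * (u n.+1 y - u n.+1 x))) -mulrN (opprB (u n.+1 y)).
      by rewrite -(sqrrN (h y * h y - h x * h x)) (opprB (h y * h y)).
    (* Up to level k_(n+1) the slice vanishes at both nodes. Above it the preceding slice has
       reached 1, since k_n + 1 <= k_(n+1), so h x >= c_n; then use h x^2 - h y^2 >= h x (h x - h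
       y). *)
    have [Fx|Fx] := leP (F x) (k n.+1)%:R.
      rewrite /u /= !step_eq0 ?subrr ?mulr0 ?expr0n ?sqr_ge0 //.
      exact: le_trans Fx.
    have un1 : u n x = 1.
      by apply: step_eq1; rewrite (le_trans _ (ltW Fx)) // ler_nat kS.
    have du := step_homo (k n.+1) yx.
    have hn := h_ge n x; rewrite un1 mulr1 in hn.
    have hd := h_diff n.+1 x y yx.
    have hy0 : 0 <= h y.
      by rewrite (le_trans _ (h_ge 0 y)) // mulr_ge0 ?step_ge0 // ltW.
    have cd0 : 0 <= c n.+1 * (u n.+1 x - u n.+1 y).
      by rewrite mulr_ge0 ?subr_ge0 // ltW.
    have hxx : c n * (c n.+1 * (u n.+1 x - u n.+1 y)) <= h x * h x - h y * h y.
      apply: (@le_trans _ _ (h x * (h x - h y))).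
        by rewrite ler_pM // ltW.
      by rewrite mulrBr lerD2l lerN2 ler_wpM2r // -subr_ge0 (le_trans cd0).
    have cd1 : 0 <= c n * (c n.+1 * (u n.+1 x - u n.+1 y)).
      by rewrite mulr_ge0 // ltW.
    by rewrite -mulrA lerXn2r ?nnegrE // (le_trans cd1).
  have lower n : n.+1%:R <= M.
    have cc0 : 0 < (c n * c n.+1) ^+ 2 by rewrite exprn_gt0 // mulr_gt0 ?c0.
    have : (form b (u n.+1) <= ((c n * c n.+1) ^- 2)%:E * form b (h \* h)%R)%E.
      apply: le_formZ => [|x y]; first by rewrite invr_ge0 ltW.
      by rewrite ler_pdivlMl // -exprMn diff.
    rewrite hhM -step_formE -EFinM lee_fin ler_pdivlMl //; apply: le_trans.
    rewrite exprMn -mulrA cE.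
    (* The small form of slice [n] sits in the denominator of c_n^2, which makes the lower bound
       large. *)
    have -> : c n ^+ 2 = 4 ^- n.+1 / step_form (k n).
      by rewrite -cE mulfK // gt_eqF ?step_form_gt0.
    rewrite mulrAC -invfM -exprD ler_pdivlMr ?step_form_gt0 //.
    by rewrite -ler_pdivlMl ?ltr0n // -invfM ltW.
  by have := lower (Num.bound M); rewrite leNgt (lt_trans (archi_boundP M0)) ?ltr_nat.
Qed.

End Unbounded.

(** * Boundedness of finite-energy functions versus closure under products *)

Theorem corollary2 (R : realType) (X : countType) (G : graph R X) :
  connected_graph G -> (canonically_compactifiable G <-> is_algebra G).
Proof.
move=> conn; split.
- move=> bdd f g fE gE; have [A fA] := bdd f fE; have [B gB] := bdd g gE.
  (* The constant A^2 + B^2 comes from Cauchy-Schwarz applied to A q + B p, rounded up to a natural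
     number. *)
  apply: (@Defs.le_finite_energy _ _ _ f g _ (Num.bound (A ^+ 2 + B ^+ 2))) => //= x y.
  have -> : f x * g x - f y * g y = f x * (g x - g y) + g y * (f x - f y) by ring.
  set p := normc (f x - f y); set q := normc (g x - g y).
  apply: (@le_trans _ _ ((A * q + B * p) ^+ 2)).
    rewrite lerXn2r ?nnegrE ?normc_ge0 //.
      by rewrite addr_ge0 // mulr_ge0 ?normc_ge0 //;
        [apply: le_trans (fA x)|apply: le_trans (gB x)]; exact: normc_ge0.
    rewrite (le_trans (le_normcD _ _)) // !normcM.
    by rewrite lerD // ler_wpM2r ?normc_ge0.
  apply: (@le_trans _ _ ((A ^+ 2 + B ^+ 2) * (p ^+ 2 + q ^+ 2))).
    rewrite -subr_ge0 [leRHS](_ : _ = (A * p - B * q) ^+ 2) ?sqr_ge0 //; ring.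
  rewrite -mulr_natl ler_wpM2r ?addr_ge0 ?sqr_ge0 // ltW // archi_boundP //.
  by rewrite addr_ge0 ?sqr_ge0.
- move=> alg f fE; apply: contrapT => fb.
  have [x0 _] := graph_nonempty G.
  pose dist x := normc (f x - f x0).
  have dist_unbounded M : exists x : X, M < dist x.
    apply: contrapT => distM; apply: fb; exists (M + normc (f x0)) => x.
    rewrite -[f x](subrK (f x0)) (le_trans (le_normcD _ _)) // lerD2r leNgt.
    by apply/negP => ?; apply: distM; exists x.
  have dist0 : dist x0 = 0 by rewrite /dist subrr normc0.
  have [h [hE hh]] := finite_form_square_infinite conn (form_dist_lt x0 fE)
    (fun x => normc_ge0 _) dist0 dist_unbounded.
  have := alg (fun x => (h x)%:C%C) (fun x => (h x)%:C%C).
  rewrite finite_energy_real => /(_ hE hE).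
  have -> : (fun x => (h x)%:C%C) \* (fun x => (h x)%:C%C) = fun x => ((h \* h) x)%:C%C.
    by apply/funext => x /=; rewrite rmorphM.
  by rewrite finite_energy_real hh ltxx.
Qed.
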